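(* Let $M$ be a discrete countable monoid and let $X$ be a subshift/SFT dynamical $M$-system. Then the automorphism group $\mathrm{Aut}(X)$ is a countable discrete group under the compact-open topology.
   Context: A dynamical $M$-system is an action of $M$ by continuous maps on a compact metrizable space. $\mathrm{Aut}(X)$ is the group of homeomorphisms $f:X\to X$ with $f(mx)=mf(x)$ for all $m\in M$, $x\in X$. Two systems are conjugate if there is an equivariant homeomorphism between them. For a finite alphabet $\Sigma$, $M$ acts on $\Sigma^M$ (product topology) by $(mx)_n=x_{nm}$. A subshift is a closed $M$-invariant subset of $\Sigma^M$; it is an SFT if there is a clopen $C\subset\Sigma^M$ such that its points are exactly the $x$ with $mx\notin C$ for all $m\in M$. $(\Sigma^2)^M$ is identified with $\Sigma^M\times\Sigma^M$. A system is subshift/SFT if it is conjugate to $Y/Z$ for some subshift $Y\subset\Sigma^M$ and SFT $Z\subset(\Sigma^2)^M$ such that $Z\cap Y^2$ is an equivalence relation on $Y$, where $Y/Z$ is the topological quotient $Y/(Z\cap Y^2)$ with action $m[y]=[my]$. *)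

(* Defs.v *)
From HB Require Import structures.
From mathcomp Require Import all_boot generic_quotient.
From mathcomp Require Import all_classical all_reals topology.

Set Implicit Arguments.
Unset Strict Implicit.
Unset Printing Implicit Defensive.

Local Open Scope classical_set_scope.
Local Open Scope quotient_scope.

Definition homeomorphism (X Y : topologicalType) (f : X -> Y) : Prop :=
  continuous f /\
  exists g : Y -> X, [/\ continuous g, cancel f g & cancel g f].

Definition metrizable (R : realType) (X : topologicalType) : Prop :=
  exists (Y : metricType R) (f : X -> Y), homeomorphism f.

Record mSpace (M : monoidType) := MSpace {
  mspace_sort :> topologicalType ;
  mact : M -> mspace_sort -> mspace_sort ;
  mact1 : forall x, mact 1%g x = x ;
  mactM : forall m n x, mact (m * n)%g x = mact m (mact n x) ;
  mact_continuous : forall m, continuous (mact m) }.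

Definition dynamical_system (R : realType) (M : monoidType) (X : mSpace M) :
  Prop := compact [set: X] /\ metrizable R X.

Definition equivariant (M : monoidType) (X Y : mSpace M) (f : X -> Y) : Prop :=
  forall m x, f (mact m x) = mact m (f x).

Definition conjugate (M : monoidType) (X Y : mSpace M) : Prop :=
  exists f : X -> Y, homeomorphism f /\ equivariant f.

Section Restriction.
Variables (M : monoidType) (X : mSpace M) (Y : set X).
Hypothesis invY : forall m x, Y x -> Y (mact m x).

Definition restr_act (m : M) (y : Y) : Y :=
  exist _ (mact m (\val y)) (mem_set (invY m (set_valP y))).

Let restr_act1 y : restr_act 1%g y = y.
Proof. by apply: val_inj; rewrite /= mact1. Qed.

Let restr_actM m n y : restr_act (m * n)%g y = restr_act m (restr_act n y).
Proof. by apply: val_inj; rewrite /= mactM. Qed.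

Let restr_act_continuous m : continuous (restr_act m).
Proof.
apply/continuousP => _ [B oB <-].
exists (mact m @^-1` B) => //.
by have /continuousP := @mact_continuous M X m; apply.
Qed.

Definition mspace_restr : mSpace M :=
  MSpace restr_act1 restr_actM restr_act_continuous.

End Restriction.

Section Quotient.
Variables (M : monoidType) (X : mSpace M) (e : equiv_rel X).
Hypothesis inve : forall m x y, e x y -> e (mact m x) (mact m y).

Local Notation Q := (quotient_topology {eq_quot e}).

Definition quot_act (m : M) (q : Q) : Q := \pi_Q (mact m (repr q)).

Lemma quot_actE m (x : X) : quot_act m (\pi_Q x) = \pi_Q (mact m x).
Proof.
apply/(@eqquotP _ e {eq_quot e})/inve.
by apply/(@eqquotP _ e {eq_quot e}); exact: (@reprK _ {eq_quot e}).
Qed.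

Let quot_act1 q : quot_act 1%g q = q.
Proof. by rewrite /quot_act mact1 reprK. Qed.

Let quot_actM m n q : quot_act (m * n)%g q = quot_act m (quot_act n q).
Proof. by rewrite [quot_act n q]/quot_act quot_actE -mactM. Qed.

Let quot_act_continuous m : continuous (quot_act m).
Proof.
apply/quotient_continuous.
rewrite (_ : _ \o _ = \pi_Q \o mact m); last first.
  by apply/funext => x /=; rewrite quot_actE.
by move=> x; apply: continuous_comp; [exact: mact_continuous|exact: pi_continuous].
Qed.

Definition mspace_quot : mSpace M :=
  MSpace quot_act1 quot_actM quot_act_continuous.

End Quotient.

Section FullShift.
Variables (M : monoidType) (S : finType).

Local Notation F := {ptws M -> discrete_topology S}.

Definition shift (m : M) (x : F) : F := fun n => x (n * m)%g.

Let shift1 x : shift 1%g x = x.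
Proof. by apply/funext => n; rewrite /shift mulg1. Qed.

Let shiftM m n x : shift (m * n)%g x = shift m (shift n x).
Proof. by apply/funext => k; rewrite /shift mulgA. Qed.

Let shift_continuous m : continuous (shift m).
Proof.
move=> x; have FF : Filter (nbhs x) by exact: nbhs_filter.
apply/(@cvg_sup _ _ _ _ _ (fmap_filter (shift m) FF)) => n U [B [oB Bx BU]].
case: oB Bx BU => C oC <- /= Bx BU.
have := @proj_continuous M (fun=> discrete_topology S) (n * m)%g x C.
move=> /(_ (open_nbhs_nbhs (conj oC Bx))) Cx.
apply: (@filterS _ (nbhs x) FF (fun y : F => C (y (n * m)%g)) _ _ Cx) => y Cy.
exact: BU.
Qed.

Definition full_shift : mSpace M := MSpace shift1 shiftM shift_continuous.

End FullShift.

Definition is_equivalence (T : Type) (r : rel T) : Prop :=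
  [/\ reflexive r, symmetric r & transitive r].

Section SubshiftSFT.
Variable M : monoidType.

Definition subshift (S : finType) (Y : set (full_shift M S)) : Prop :=
  closed Y /\ forall m x, Y x -> Y (mact m x).

Definition SFT (S : finType) (Z : set (full_shift M S)) : Prop :=
  exists C : set (full_shift M S),
    clopen C /\ Z = [set x | forall m, ~ C (mact m x)].

(* The identification of (S * S)^M with S^M * S^M. *)
Definition pair_conf (S : finType) (x y : full_shift M S) :
  full_shift M (S * S)%type := fun n => (x n, y n).

Definition pair_rel (S : finType) (Y : set (full_shift M S))
  (Z : set (full_shift M (S * S)%type)) : rel Y :=
  fun y y' => `[< Z (pair_conf (\val y) (\val y')) >].

Arguments pair_rel {S} Y Z.

Lemma SFT_invariant (S : finType) (Z : set (full_shift M S)) :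
  SFT Z -> forall m x, Z x -> Z (mact m x).
Proof. by move=> [C [_ ->]] m x Zx n; rewrite -mactM; exact: Zx. Qed.

Section Presentation.
Variables (S : finType) (Y : set (full_shift M S)).
Variable Z : set (full_shift M (S * S)%type).
Hypotheses (sY : subshift Y) (sZ : SFT Z).
Hypothesis eqZ : is_equivalence (pair_rel Y Z).

Definition subshift_mspace : mSpace M := mspace_restr sY.2.

Definition pair_equiv : equiv_rel subshift_mspace :=
  let: And3 r s t := eqZ in EquivRel (pair_rel Y Z) r s t.

Lemma pair_equiv_act m (y y' : subshift_mspace) :
  pair_equiv y y' -> pair_equiv (mact m y) (mact m y').
Proof.
rewrite /pair_equiv; case: eqZ => r s t /= /asboolP h.
apply/asboolP; exact: (SFT_invariant sZ m h).
Qed.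

Definition subshift_quotient : mSpace M := mspace_quot pair_equiv_act.

End Presentation.

Definition subshift_SFT (X : mSpace M) : Prop :=
  exists (S : finType) (Y : set (full_shift M S))
         (Z : set (full_shift M (S * S)%type))
         (sY : subshift Y) (sZ : SFT Z)
         (eqZ : is_equivalence (pair_rel Y Z)),
    conjugate X (subshift_quotient sY sZ eqZ).

End SubshiftSFT.

Section Aut.
Variables (M : monoidType) (X : mSpace M).

Definition automorphisms : set {compact-open, X -> X} :=
  [set f | homeomorphism f /\ equivariant f].

(* [set_type] carries the topology induced by the compact-open one. *)
Definition aut : Type := set_type automorphisms.

HB.instance Definition _ := Topological.on aut.

Implicit Types f g : aut.

Definition mk_aut (f : X -> X) (af : automorphisms f) : aut :=
  exist (fun h => h \in automorphisms) f (mem_set af).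

Definition aut_fun f : X -> X := \val f.

Lemma aut_homeo f : homeomorphism (aut_fun f).
Proof. by have [] := set_valP f. Qed.

Lemma aut_equivariant f : equivariant (aut_fun f).
Proof. by have [] := set_valP f. Qed.

Lemma aut_ext f g : aut_fun f =1 aut_fun g -> f = g.
Proof. by move=> fg; apply/val_inj/funext. Qed.

Lemma id_aut : automorphisms id.
Proof. by split => //; split; [|exists id; split] => // x; exact: cvg_id. Qed.

Definition aut_one : aut := mk_aut id_aut.

Lemma comp_aut f g : automorphisms (aut_fun f \o aut_fun g).
Proof.
have [cf [f' [cf' fK f'K]]] := aut_homeo f.
have [cg [g' [cg' gK g'K]]] := aut_homeo g.
split; last by move=> m x /=; rewrite !aut_equivariant.
split; first by move=> x; apply: continuous_comp; [exact: cg|exact: cf].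
exists (g' \o f'); split; [|exact: can_comp|exact: can_comp].
by move=> x; apply: continuous_comp; [exact: cf'|exact: cg'].
Qed.

Definition aut_mul f g : aut := mk_aut (comp_aut f g).

Definition aut_inv_fun f : X -> X := projT1 (cid (aut_homeo f).2).

Lemma aut_funK f : cancel (aut_fun f) (aut_inv_fun f).
Proof. by rewrite /aut_inv_fun; case: cid => g []. Qed.

Lemma aut_inv_funK f : cancel (aut_inv_fun f) (aut_fun f).
Proof. by rewrite /aut_inv_fun; case: cid => g []. Qed.

Lemma inv_aut f : automorphisms (aut_inv_fun f).
Proof.
split; last first.
  by move=> m x; apply: (can_inj (aut_funK f));
    rewrite aut_equivariant !aut_inv_funK.
split; first by rewrite /aut_inv_fun; case: cid => g [].
exists (aut_fun f); split; [exact: (aut_homeo f).1|exact: aut_inv_funK|].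
exact: aut_funK.
Qed.

Definition aut_inv f : aut := mk_aut (inv_aut f).

Let aut_mulA : associative aut_mul.
Proof. by move=> f g h; exact: aut_ext. Qed.

Let aut_mul1 : left_id aut_one aut_mul.
Proof. by move=> f; exact: aut_ext. Qed.

Let aut_mulr1 : right_id aut_one aut_mul.
Proof. by move=> f; exact: aut_ext. Qed.

Let aut_mulV : left_inverse aut_one aut_inv aut_mul.
Proof. by move=> f; apply: aut_ext => x; exact: aut_funK. Qed.

Let aut_mulrV : right_inverse aut_one aut_inv aut_mul.
Proof. by move=> f; apply: aut_ext => x; exact: aut_inv_funK. Qed.

HB.instance Definition _ := isGroup.Build aut
  aut_mulA aut_mul1 aut_mulr1 aut_mulV aut_mulrV.

End Aut.

(* Main.v *)
Require Import Defs.
From HB Require Import structures.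
From mathcomp Require Import all_boot all_algebra finmap generic_quotient.
From mathcomp Require Import all_classical all_reals topology.

Set Implicit Arguments.
Unset Strict Implicit.
Unset Printing Implicit Defensive.

Local Open Scope classical_set_scope.
Local Open Scope quotient_scope.

(** A subshift/SFT system [X] is expansive: there is an open neighbourhood [U]
    of the diagonal of [X * X] such that two points whose orbits stay
    [U]-close under the whole monoid are equal
    ([subshift_SFT_expansive]). Indeed, write [q : Y -> X] for the quotient
    map, and let the SFT [Z] consist of the points whose translates avoid the
    clopen set [C]. The image [K] under [q * q] of the compact set of pairs
    of [Y] lying in [C] is closed, misses the diagonal because pairs in [Z]
    are not in [C], and is met by some translate of every pair of distinct
    points; so [U := ~` K] works.

    Given such a [U], an automorphism [f] is determined by its values up to
    [U]: if [(f x, g x)] lies in [U] for all [x], then equivariance puts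
    [(m (f x), m (g x)) = (f (m x), g (m x))] in [U] for all [m], whence
    [f = g]. By compactness [f] is described up to [U] by finitely many
    pairs [(V, W)] of members of a countable basis of [X], where the sets [V]
    cover [X], [W * W] is included in [U] and [f] maps the closure of [V] into
    [W] (a certificate of [f], see [certificate_exists] and
    [certificate_eq]). There are countably many finite sets of pairs, so
    there are countably many automorphisms; and sending the compact closures
    of the sets [V] into the open sets [W] is an open condition for the
    compact-open topology, so every singleton is open. Continuity of the group
    operations is then immediate. *)

(** * General topology *)

(** Compactness in terms of open covers, without a base point. *)
Lemma compact_finite_cover (T : topologicalType) (A : set T) :
  compact A -> cover_compact A.
Proof.
have [->|/set0P[x _]] := eqVneq A set0.
  by move=> _ I D F _ _; exists fset0%fset.
pose T' : ptopologicalType := HB.pack T (isPointed.Build T x).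
move=> cA; have : @cover_compact T' A by rewrite -compact_cover.
exact.
Qed.

Lemma compact_subtype (T : topologicalType) (A : set T) :
  compact A -> compact [set: A].
Proof.
move=> cA F PF _.
have FA : (set_val @ F) A.
  by apply: (@filterS _ F _ setT _ _ filterT) => y _; exact: set_valP.
have [x [Ax clx]] := cA (set_val @ F) (fmap_proper_filter _ PF) FA.
exists (exist _ x (mem_set Ax)); split=> // B C FB.
rewrite nbhsE => -[D [[O oO <-] Ox] DC].
have [_ [[y By <-] Oy]] : (set_val @` B) `&` O !=set0.
  apply: clx; last exact: open_nbhs_nbhs.
  by apply: (@filterS _ F _ B _ _ FB) => y By; exists y.
by exists y; split => //; exact: DC.
Qed.

Lemma cluster_nbhs_continuous (X Y : topologicalType) (f : X -> Y) (p q : X) :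
  continuous f -> cluster (nbhs p) q -> cluster (nbhs (f p)) (f q).
Proof.
move=> cf clpq A B fpA fqB.
by have [x [Ax Bx]] := clpq _ _ (cf p A fpA) (cf q B fqB); exists (f x).
Qed.

Lemma injective_hausdorff (X Y : topologicalType) (f : X -> Y) :
  continuous f -> injective f -> hausdorff_space Y -> hausdorff_space X.
Proof.
by move=> cf fI hY p q clpq; apply/fI/hY; exact: cluster_nbhs_continuous.
Qed.

Lemma hausdorff_setX (X Y : topologicalType) :
  hausdorff_space X -> hausdorff_space Y -> hausdorff_space (X * Y)%type.
Proof.
move=> hX hY [x y] [x' y'] clpq; congr pair.
- apply: hX; apply: (@cluster_nbhs_continuous _ _ fst _ _ _ clpq) => ?.
  exact: cvg_fst.
- apply: hY; apply: (@cluster_nbhs_continuous _ _ snd _ _ _ clpq) => ?.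
  exact: cvg_snd.
Qed.

Lemma metrizable_hausdorff (R : realType) (X : topologicalType) :
  metrizable R X -> hausdorff_space X.
Proof.
move=> [Y [f [cf [g [_ fK _]]]]].
exact: injective_hausdorff cf (can_inj fK) (@metric_hausdorff _ Y).
Qed.

Lemma compact_metrizable_second_countable (R : realType)
    (X : topologicalType) :
  compact [set: X] -> metrizable R X -> @second_countable X.
Proof.
move=> cX [Y [f [cf [g [cg fK gK]]]]].
have [B cB [oB nB]] : @second_countable Y.
  have [Y0|/set0P[y _]] := eqVneq [set: Y] set0.
    exists set0; first exact: countable0.
    split=> // x.
    by have : [set: Y] x by []; rewrite Y0.
  pose Y' : pseudoPMetricType R := HB.pack Y (isPointed.Build Y y).
  apply: (@compact_second_countable R Y').
  have -> : [set: Y] = f @` setT by apply/seteqP; split=> // z _; exists (g z).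
  by apply: continuous_compact => //; exact: continuous_subspaceT.
exists [set f @^-1` V | V in B]; first exact: (sub_countable (card_image_le _ _)).
split=> [_ [V BV <-]|x A xA]; first by move/continuousP: cf; apply; exact: oB.
have gA : nbhs (f x) (g @^-1` A) by apply: cg; rewrite fK.
have [V [BV Vfx] VA] := nB (f x) _ gA.
exists (f @^-1` V); first by split=> //; exists V.
by move=> z Vz; have := VA _ Vz; rewrite /= fK.
Qed.

(** * Expansiveness of subshift/SFT systems *)

(** Topological expansiveness; the neighbourhood [U] of the diagonal plays the
    role of an expansivity constant, so that no metric is needed. *)
Definition expansive (M : monoidType) (X : mSpace M) : Prop :=
  exists U : set (X * X), [/\ open U, forall x, U (x, x) &
    forall x y, (forall m, U (mact m x, mact m y)) -> x = y].

Lemma full_shift_compact (M : monoidType) (S : finType) :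
  compact [set: full_shift M S].
Proof.
have -> : [set: full_shift M S] =
    [set f : forall i : M, discrete_topology S | forall i, setT (f i)].
  by apply/seteqP; split.
apply: (@tychonoff M (fun=> discrete_topology S) (fun=> setT)) => i.
exact/finite_compact/(@finite_finset S).
Qed.

Lemma pair_conf_continuous (M : monoidType) (S : finType)
    (Y : set (full_shift M S)) :
  continuous (fun p : Y * Y => pair_conf (\val p.1) (\val p.2)).
Proof.
have valn (y : Y) n :
    nbhs y [set z : Y | (\val z : full_shift M S) n = \val y n].
  have := @proj_continuous M (fun=> discrete_topology S) n (\val y) _
    (open_nbhs_nbhs (conj (discrete_open [set (\val y) n]) erefl)).
  exact: (@initial_continuous Y (full_shift M S) set_val y).
move=> p; have FF : Filter (nbhs p) by exact: nbhs_filter.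
apply/(@cvg_sup _ _ _ _ _ (fmap_filter _ FF)) => n V [W [[D oD <-] /= Dp DV]].
(* Coordinate [n] of the pair is constant on this neighbourhood of [p]. *)
exists ([set z : Y | (\val z : full_shift M S) n = \val p.1 n],
        [set z : Y | (\val z : full_shift M S) n = \val p.2 n]) => /=.
  by split; exact: valn.
by move=> [y z] [/= yn zn]; apply: DV; rewrite /pair_conf /= yn zn.
Qed.

Lemma subshift_SFT_expansive (M : monoidType) (X : mSpace M) :
  hausdorff_space X -> subshift_SFT X -> expansive X.
Proof.
move=> hX [S [Y [Z [sY [sZ [eqZ [f [[cf [g [cg fK gK]]] ef]]]]]]]].
have [C [[oC cC] ZE]] := sZ.
pose T := subshift_mspace sY.
pose e : equiv_rel T := pair_equiv sY eqZ.
pose Q := quotient_topology {eq_quot e}.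
pose q (y : T) : X := g (\pi_Q y : subshift_quotient sY sZ eqZ).
have cq : continuous q.
  by move=> y; apply: continuous_comp; [exact: pi_continuous|exact: cg].
have qE y z : q y = q z <-> Z (pair_conf (\val y) (\val z)).
  have eE : e y z = pair_rel Z y z by rewrite /e /pair_equiv; case: (eqZ).
  have <- : e y z <-> Z (pair_conf (\val y) (\val z)).
    by rewrite eE /pair_rel; split => /asboolP.
  split=> [/(can_inj gK)|yz]; last congr g.
    by move/(@eqquotP _ e {eq_quot e}).
  exact/(@eqquotP _ e {eq_quot e}).
have qm m y : q (mact m y) = mact m (q y).
  apply: (can_inj fK); rewrite ef /q !gK.
  by apply: esym; exact: (quot_actE (@pair_equiv_act M S Y Z sY sZ eqZ)).
have qs x : exists y, q y = x.
  by exists (repr (f x : Q)); rewrite /q reprK fK.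
pose C' := [set p : T * T | C (pair_conf (\val p.1) (\val p.2))].
pose K := (fun p : T * T => (q p.1, q p.2)) @` C'.
have cK : compact K.
  apply: continuous_compact.
    apply: continuous_subspaceT => p; apply: cvg_pair.
      by apply: continuous_comp; [exact: cvg_fst|exact: cq].
    by apply: continuous_comp; [exact: cvg_snd|exact: cq].
  have cY : compact Y.
    exact: subclosed_compact sY.1 (@full_shift_compact _ _) _.
  have cT : compact [set: T] by exact: compact_subtype cY.
  apply: (subclosed_compact _ (compact_setX cT cT)) => //.
  by move/continuous_closedP: (@pair_conf_continuous M S Y); apply.
exists (~` K); split.
- by apply: closed_openC; apply: compact_closed cK; exact: hausdorff_setX.
- move=> x [[y z] /= Cyz [<-]] /esym/qE; rewrite ZE => /(_ 1%g); rewrite mact1.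
  exact.
- move=> x x'; have [y <-] := qs x; have [z <-] := qs x' => yz.
  apply/qE; rewrite ZE => m Cm; apply: (yz m).
  by exists (mact m y, mact m z) => //=; rewrite !qm.
Qed.

(** * Automorphisms of compact expansive systems *)

Section Certificates.
Variables (M : monoidType) (X : mSpace M) (U : set (X * X)) (B : set (set X)).

(** Finite sets of pairs [(V, W)] of members of [B] that describe [f] with
    precision [U]: the sets [V] cover the space, and [f] sends the closure of
    [V] into the open set [W], two points of which are always [U]-close.
    Closures are used because they are compact, which makes the condition on
    [f] open for the compact-open topology. *)
Definition certificate (f : X -> X) : set {fset set X * set X} :=
  [set s | [/\ {subset s <= B `*` B},
    forall p, p \in s -> [/\ open p.2, p.2 `*` p.2 `<=` U &
                            f @` closure p.1 `<=` p.2] &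
    forall x, exists2 p, p \in s & p.1 x]].

Hypothesis oU : open U.
Hypothesis U1 : forall x, U (x, x).
Hypothesis UE : forall x y, (forall m, U (mact m x, mact m y)) -> x = y.

(** Expansiveness makes a certificate determine the automorphism. *)
Lemma certificate_eq (f g : aut X) s :
  certificate (aut_fun f) s ->
  (forall p, p \in s -> aut_fun g @` closure p.1 `<=` p.2) -> f = g.
Proof.
move=> [_ sf sc] sg; apply: aut_ext => x; apply: UE => m.
rewrite -!aut_equivariant.
have [p ps px] := sc (mact m x).
have [_ pU fp] := sf _ ps.
apply: pU; split; [apply: fp|apply: (sg _ ps)].
- by exists (mact m x) => //; exact: subset_closure.
- by exists (mact m x) => //; exact: subset_closure.
Qed.

Hypothesis cX : compact [set: X].
Hypothesis hX : hausdorff_space X.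
Hypothesis bB : basis B.

Lemma certificate_exists (f : X -> X) : continuous f -> certificate f !=set0.
Proof.
move=> cf; have [oB nB] := bB.
pose D := [set p : set X * set X | [/\ (B `*` B) p,
  p.2 `*` p.2 `<=` U & f @` closure p.1 `<=` p.2]].
have [|x _|s sD sc] := compact_finite_cover cX (D := D) (f := fst).
- by move=> p [[Bp _] _ _]; exact: oB.
- have : nbhs (f x, f x) U by exact: open_nbhs_nbhs.
  case=> -[P Q] /= [xP xQ] PQU.
  have [W [BW Wx] WPQ] := nB (f x) _ (filterI xP xQ).
  have xW : nbhs x (f @^-1` W).
    by apply: cf; apply: open_nbhs_nbhs; split => //; exact: oB.
  have [N xN NW] := compact_regular hX cX filterT xW.
  have [V [BV Vx] VN] := nB x _ xN.
  exists (V, W) => //; split => //=.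
    by move=> [y z] [/= /WPQ[Py _] /WPQ[_ Qz]]; exact: PQU.
  by move=> _ [y /(closureS VN)/NW Wy <-].
exists s; split.
- by move=> p /sD/set_mem[Bp _ _]; exact: mem_set.
- by move=> p /sD/set_mem[[_ Bp2] ? ?]; split => //; exact: oB.
- by move=> x; have [//|p ps px] := sc x; exists p.
Qed.

Lemma aut_open1 (f : aut X) : open [set f].
Proof.
have [s cs] := certificate_exists (aut_homeo f).1.
have [_ sf _] := cs.
pose O : set {compact-open, X -> X} :=
  \bigcap_(p in [set` s]) [set g | g @` closure p.1 `<=` p.2].
exists O.
  rewrite openE => g Og; apply: filter_bigI => p ps.
  have [op2 _ _] := sf _ ps.
  apply: open_nbhs_nbhs; split; last exact: Og.
  apply: compact_open_open => //.
  by apply: (subclosed_compact _ cX) => //; exact: closed_closure.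
apply/seteqP; split=> g /=; last by move=> -> p /sf[].
by move=> Og; apply/esym; apply: (certificate_eq cs) => p ps; exact: Og.
Qed.

Lemma aut_countable : countable B -> countable [set: aut X].
Proof.
move=> cB.
have cs (f : aut X) := certificate_exists (aut_homeo f).1.
pose c f := projT1 (cid (cs f)).
have cc f : certificate (aut_fun f) (c f) by rewrite /c; case: cid.
have cI : injective c.
  move=> f g fg; apply: (certificate_eq (cc f)) => p; rewrite fg.
  by have [_ sg _] := cc g => /sg[].
have <- : c @^-1` [set s : {fset _} | {subset s <= B `*` B}] = setT.
  by apply/seteqP; split=> // f _; have [] := cc f.
apply: sub_countable (card_ge_preimage (in2W cI)) _.
by apply: fset_subset_countable; exact: countableX.
Qed.

End Certificates.

Theorem proposition7p14 (R : realType) (M : monoidType)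
    (cM : countable [set: M]) (X : mSpace M) (dsX : dynamical_system R X)
    (sX : subshift_SFT X) :
  [/\ countable [set: aut X],
      continuous (fun fg : aut X * aut X => (fg.1 * fg.2)%g),
      continuous (fun f : aut X => (f^-1)%g)
    & forall A : set (aut X), open A].
Proof.
have [cX mX] := dsX; have hX := metrizable_hausdorff mX.
have [B cB bB] := compact_metrizable_second_countable cX mX.
have [U [oU U1 UE]] := subshift_SFT_expansive hX sX.
have o1 (f : aut X) : open [set f] by exact: aut_open1 oU U1 UE cX hX bB f.
have n1 (f : aut X) : nbhs f [set f] by exact: open_nbhs_nbhs.
split.
- exact: aut_countable oU U1 UE cX hX bB cB.
- move=> [f g] A /nbhs_singleton Afg.
  exists ([set f], [set g]) => //.
  by move=> [f' g'] [/= -> ->].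
- move=> f A /nbhs_singleton Af.
  by apply: filterS (n1 f) => _ ->.
- move=> A; have -> : A = \bigcup_(f in A) [set f].
    by rewrite bigcup_imset1 image_id.
  exact: bigcup_open.
Qed.
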